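(* Let $S$ be a countable set, $\mathcal{H}$ a Hilbert space, and let $(\mathbf{v}(s))_{s\in S}$ be a Bessel sequence in $\mathcal{H}$ with Bessel constant $A$. Let $V\colon\mathcal{H}\to\ell^2(S)$, $Vf=(\langle\mathbf{v}(s)\mid f\rangle)_{s\in S}$, be its analysis operator. (a) Then the closed span $\mathcal{H}_{\mathrm{in}}$ of $(\mathbf{v}(s))_{s\in S}$ contains a derived Parseval frame. (b) The derived Parseval frame is a Parseval frame for $\mathcal{H}$ if and only if $(\mathbf{v}(s))_{s\in S}$ is a frame for $\mathcal{H}$, i.e., iff $\mathcal{H}_{\mathrm{in}}=\mathcal{H}$. (c) In the general case when $(\mathbf{v}(s))_{s\in S}$ is a Bessel sequence, the operator $W:=V(V^{*}V)^{-1/2}$ is well defined and isometric on $\mathcal{H}_{\mathrm{in}}$, and $$\mathbf{w}(s):=(V^{*}V)^{-1/2}\mathbf{v}(s),\qquad s\in S,$$ is a Parseval frame in $\mathcal{H}_{\mathrm{in}}$.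
   Context: Hilbert spaces are real or complex, and inner products are conjugate-linear in the first variable. A system $(\mathbf{v}(s))_{s\in S}$ in $\mathcal{H}$ is a frame for $\mathcal{H}$ if there are constants $0<A_1\le A_2<\infty$ such that $A_1\|f\|^2\le\sum_{s\in S}|\langle\mathbf{v}(s)\mid f\rangle|^2\le A_2\|f\|^2$ for all $f\in\mathcal{H}$. It is a Bessel sequence with (finite) Bessel constant $A$ if only the upper estimate $\sum_{s\in S}|\langle\mathbf{v}(s)\mid f\rangle|^2\le A\|f\|^2$ for all $f\in\mathcal{H}$ is assumed; then $V$ is well defined and bounded, with adjoint $V^{*}(\xi_s)=\sum_{s\in S}\xi_s\mathbf{v}(s)$. A Parseval frame for (or in) a Hilbert space $\mathcal{L}$ is a family $(\mathbf{w}(s))_{s\in S}$ in $\mathcal{L}$ with $\sum_{s\in S}|\langle\mathbf{w}(s)\mid f\rangle|^2=\|f\|^2$ for all $f\in\mathcal{L}$ (a frame with $A_1=A_2=1$). The ''derived Parseval frame'' in (a) and (b) is the system $(\mathbf{w}(s))_{s\in S}$ displayed in (c). The operator $(V^{*}V)^{1/2}$ is defined by the spectral theorem applied to the selfadjoint operator $V^{*}V$; $(V^{*}V)^{-1/2}$ denotes the (possibly unbounded) inverse of its restriction to $\mathcal{H}_{\mathrm{in}}$, defined on the range of $(V^{*}V)^{1/2}$, which is dense in $\mathcal{H}_{\mathrm{in}}$, and $W$ on $\mathcal{H}_{\mathrm{in}}$ is understood as the extension by continuity, i.e. the partial isometry in the polar decomposition $V=W(V^{*}V)^{1/2}$ restricted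 to its initial space $\mathcal{H}_{\mathrm{in}}$.
   Formalization: In (b), ''Parseval for H (or H_in = H) implies v is a frame'' is dropped as false: v(n)=e_n/(n+1) in l^2(N) has w(n)=e_n Parseval and H_in=H but no lower frame bound. Proved instead: Parseval for H iff H_in = H, and v a frame implies Parseval for H. *)

(* Defs.v *)
From HB Require Import structures.
From mathcomp Require Import all_boot all_order all_algebra.
From mathcomp Require Import complex.
From mathcomp Require Import all_classical all_reals all_analysis.
From mathcomp Require Import summability.

Set Implicit Arguments.
Unset Strict Implicit.
Unset Printing Implicit Defensive.

Import Order.TTheory GRing.Theory Num.Theory.
Import numFieldNormedType.Exports.

Local Open Scope classical_set_scope.
Local Open Scope ring_scope.

Variant scalar_kind := RealScalars | ComplexScalars.

Definition scalars (R : realType) (k : scalar_kind) : numFieldType :=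
  match k with RealScalars => R | ComplexScalars => R[i] end.

Definition sconj (R : realType) (k : scalar_kind) :
    scalars R k -> scalars R k :=
  match k with RealScalars => id | ComplexScalars => @conjc R end.

Section SconjTheory.
Context (R : realType) (k : scalar_kind).

Fact sconj_is_zmod_morphism : zmod_morphism (@sconj R k).
Proof. by case: k => // x y; rewrite /= rmorphB. Qed.

Fact sconj_is_monoid_morphism : monoid_morphism (@sconj R k).
Proof. by case: k; split=> //=; [exact: conjc1 | exact: (rmorphM (@conjc R))]. Qed.

Fact sconj_involutive : involutive (@sconj R k).
Proof. by case: k => // x; exact: conjcK. Qed.

HB.instance Definition _ :=
  GRing.isZmodMorphism.Build _ _ (@sconj R k) sconj_is_zmod_morphism.
HB.instance Definition _ :=
  GRing.isMonoidMorphism.Build _ _ (@sconj R k) sconj_is_monoid_morphism.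
HB.instance Definition _ := isInvolutive.Build _ (@sconj R k) sconj_involutive.

End SconjTheory.

Definition sRe (R : realType) (k : scalar_kind) : scalars R k -> R :=
  match k with RealScalars => id | ComplexScalars => @complex.Re R end.

(* Norms over [scalars R k] take their values in [scalars R k]; [hnorm] is the
   same norm with values in [R]. *)
Definition hnorm (R : realType) (k : scalar_kind)
    (E : normedModType (scalars R k)) (x : E) : R := sRe `|x|.

(* [{dot H for theta}] is linear in its first argument and conjugate-linear in
   its second one, whence the swap in [inner]. *)
HB.mixin Record isHilbert (R : realType) (k : scalar_kind) H
    & CompleteNormedModule (scalars R k) H := {
  hdot : {dot H for @sconj R k} ;
  hdot_normE : forall x : H, hdot x x = `|x| ^+ 2
}.

#[short(type="hilbertType")]
HB.structure Definition Hilbert (R : realType) (k : scalar_kind) :=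
  {H of isHilbert R k H & CompleteNormedModule (scalars R k) H}.

Definition inner (R : realType) (k : scalar_kind) (H : hilbertType R k)
  (x y : H) : scalars R k := hdot y x.


Section Frames.
Context (R : realType) (k : scalar_kind) (S : countType) (H : hilbertType R k).
Local Notation K := (scalars R k).
Implicit Types (v w : S -> H) (L : set H) (xi eta : S -> K).

Definition sqsum xi : \bar R := \esum_(s in [set: S]) ((sRe `|xi s|) ^+ 2)%:E.

Definition analysis v : H -> S -> K := fun f s => inner (v s) f.

Definition bessel v (A : R) :=
  forall f : H, (sqsum (analysis v f) <= (A * hnorm f ^+ 2)%:E)%E.

Definition frame v := exists A1 A2 : R, [/\ 0 < A1, A1 <= A2 &
  forall f : H,
    ((A1 * hnorm f ^+ 2)%:E <= sqsum (analysis v f))%E /\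
    (sqsum (analysis v f) <= (A2 * hnorm f ^+ 2)%:E)%E].

(* [L] is meant to be a closed subspace of [H], viewed as a Hilbert space. *)
Definition parseval_frame_in L w := (forall s, L (w s)) /\
  forall f, L f -> sqsum (analysis w f) = (hnorm f ^+ 2)%:E.

Definition closed_span v : set H :=
  closure [set f | exists (r : seq S) (c : S -> K),
                     f = \sum_(s <- r) c s *: v s].

(* The Hilbert space l^2(S), as a subspace of [S -> K]; [sum] is the
   unconditional sum, the limit along the finite subsets of [S]. *)
Definition l2 : set (S -> K) := [set xi | (sqsum xi < +oo)%E].
Definition l2norm xi : R := Num.sqrt (fine (sqsum xi)).
Definition l2inner xi eta : K := sum (fun s => (sconj (xi s) * eta s) : K^o).

(* [get P] is a chosen element of [P], and a default value if [P] is empty. *)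
Definition adjoint (V : H -> S -> K) (xi : S -> K) : H :=
  get [set y | forall f, inner y f = l2inner xi (V f)].

Definition positive_operator (T : H -> H) := [/\ linear T, continuous T,
  forall f g, inner f (T g) = inner (T f) g & forall f, 0 <= inner f (T f)].

Definition is_sqrt_operator (P T : H -> H) := positive_operator T /\ T \o T = P.

(* A bounded positive operator has exactly one positive square root, the one
   which the spectral theorem provides. *)
Definition sqrt_operator (P : H -> H) : H -> H := get (is_sqrt_operator P).

Definition abs_analysis v : H -> H :=
  sqrt_operator (adjoint (analysis v) \o analysis v).

Definition inv_abs_dom v : set H := abs_analysis v @` closed_span v.
Definition inv_abs v (y : H) : H :=
  get [set x | closed_span v x /\ abs_analysis v x = y].

Definition derived v : S -> H := fun s => inv_abs v (v s).

(* [xi] is the l^2-limit of [V ((V^* V)^(-1/2) y)] as [y] tends to [f] within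
   the domain of [(V^* V)^(-1/2)]. *)
Definition is_polar_value v (f : H) xi := l2 xi /\
  l2norm (analysis v (inv_abs v y) - xi)
    @[y --> within (inv_abs_dom v) (nbhs f)] --> (0 : R).

Definition polar v (f : H) : S -> K := get (is_polar_value v f).

End Frames.

(* Main.v *)
Require Import Defs.
From HB Require Import structures.
From mathcomp Require Import all_boot all_order all_algebra finmap.
From mathcomp Require Import complex.
From mathcomp Require Import all_classical all_reals all_analysis.
From mathcomp Require Import summability ring lra.
Set Implicit Arguments.
Unset Strict Implicit.
Unset Printing Implicit Defensive.
Import Order.TTheory GRing.Theory Num.Theory.
Import numFieldNormedType.Exports.
Local Open Scope classical_set_scope.
Local Open Scope ring_scope.

(** Write [T] for the positive square root of the frame operator [P = V* V] and
    [Hin] for the closed span of the [v s].  The identity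
    [|V x|^2 = <x | P x> = |T x|^2] says that [T x |-> V x] is a well defined
    isometry on the range of [T]; this is [W], and everything follows from it.

    Evaluating this isometry at [s] gives a linear functional [T x |-> <v s | x>]
    of norm at most 1 on the range of [T].  By the Riesz theorem ([riesz]) it is
    [y |-> <w s | y>] for some [w s] in the closure of that range, which is [Hin]
    ([closure_range_abs]).  As [T] is symmetric, [<T (w s) | x> = <v s | x>], that
    is [T (w s) = v s]: every [v s] lies in the domain of [T^-1], and [w s] is
    its image there ([range_abs_in], [derivedP]).  By construction the analysis
    operator of [w] maps [T x] to [V x] ([analysis_derived]), so it agrees with
    [W] on the range of [T]; the Parseval identity holds there, and extends to
    [Hin] by density ([parseval_derived]).  For (b), a vector orthogonal to all
    the [v s] is orthogonal to all the [w s], hence vanishes when [w] is a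
    Parseval frame of the whole space.

    Every argument about [T] uses only that it is some positive square root of
    [P]; what must be shown is that one exists ([exists_sqrt]).  After scaling,
    [P = 1 - B] with [B] a symmetric contraction, and a square root of [1 - B] is
    [1 - Y] with [Y] the limit of [Y' = (B + Y^2) / 2] started at 0.  All iterates
    commute, so each increment is estimated by the corresponding increment of
    the same recursion over the reals with [B] replaced by 1
    ([sq_iter_step]); that real sequence is increasing and bounded, hence the
    operators converge in norm.

    The Riesz theorem is proved by minimising [|x|^2 - 2 Re (phi x)]; it also
    provides orthogonal decompositions ([orthogonal_decomposition]). *)

(** * Scalars *)

Definition ofR (R : realType) (k : scalar_kind) : R -> scalars R k :=
  match k with RealScalars => id | ComplexScalars => real_complex R end.

Section Scalars.
Context (R : realType) (k : scalar_kind).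
Local Notation K := (scalars R k).
Local Notation emb := (@ofR R k).
Implicit Types (a b : R) (x y : K).

Fact ofR_is_zmod_morphism : zmod_morphism emb.
Proof. by case: k => // a b; rewrite /= rmorphB. Qed.

Fact ofR_is_monoid_morphism : monoid_morphism emb.
Proof. by case: k; split=> // a b; rewrite /= rmorphM. Qed.

HB.instance Definition _ := GRing.isZmodMorphism.Build _ _ emb ofR_is_zmod_morphism.
HB.instance Definition _ :=
  GRing.isMonoidMorphism.Build _ _ emb ofR_is_monoid_morphism.

Fact sRe_is_zmod_morphism : zmod_morphism (@sRe R k).
Proof. by case: k => //= x y; rewrite raddfB. Qed.

HB.instance Definition _ :=
  GRing.isZmodMorphism.Build _ _ (@sRe R k) sRe_is_zmod_morphism.

Lemma ofRK : cancel emb (@sRe R k).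
Proof. by case: k. Qed.

Lemma ler_ofR a b : (emb a <= emb b) = (a <= b).
Proof. by case: k => //=; rewrite lecR. Qed.

Lemma ltr_ofR a b : (emb a < emb b) = (a < b).
Proof. by case: k => //=; rewrite ltcR. Qed.

Lemma sconj_ofR a : sconj (emb a) = emb a.
Proof. by case: k => //=; rewrite oppr0. Qed.

Lemma sRe_conj x : sRe (sconj x) = sRe x.
Proof. by case: k x => //= -[]. Qed.

Lemma sRe_ofRM a x : sRe (emb a * x) = a * sRe x.
Proof. by case: k x => //= -[u w]; rewrite /= mul0r subr0. Qed.

Lemma mul_sconj x : sconj x * x = `|x| ^+ 2.
Proof.
case: k x => /= x; first by rewrite real_normK ?num_real// expr2.
by rewrite mulrC -sqr_normc.
Qed.

Lemma sconj_fixed x : sconj x = x -> emb (sRe x) = x.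
Proof.
case: k x => //= -[u w] /= /eqP; rewrite eq_complex /= => /andP[_ /eqP h].
by apply/eqP; rewrite eq_complex /= eqxx /=; apply/eqP; lra.
Qed.

Lemma ge0_sconj x : 0 <= x -> sconj x = x.
Proof.
case: k x => //= -[u w]; rewrite lecE /= => /andP[/eqP -> _].
by rewrite oppr0.
Qed.

Lemma ge0_sReK x : 0 <= x -> emb (sRe x) = x.
Proof. by move=> /ge0_sconj /sconj_fixed. Qed.

Lemma sRe_le_norm x : sRe x <= sRe `|x|.
Proof.
case: k x => /= [x|[u w] /=]; first exact: ler_norm.
by rewrite (le_trans (ler_norm _))// -sqrtr_sqr ler_wsqrtr// lerDl sqr_ge0.
Qed.

End Scalars.
(** The modulus of a scalar, as a real number. *)
Notation smod x := (sRe `|x|).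

(** * Real-valued norms and inner products *)

Lemma cvg_ext (T : Type) (U : nbhsType) (F : set_system T) (f g : T -> U) (l : U) :
  (forall t, f t = g t) -> g @ F --> l -> f @ F --> l.
Proof. by move=> /funext ->. Qed.

Section Norm.
Context (R : realType) (k : scalar_kind).
Local Notation K := (scalars R k).
Local Notation emb := (@ofR R k).
Context (E : normedModType K).
Implicit Types (a : K) (x y : E).

Lemma ofR_hnorm x : emb (hnorm x) = `|x|.
Proof. by rewrite /hnorm ge0_sReK. Qed.

Lemma hnorm_ge0 x : 0 <= hnorm x.
Proof. by rewrite -(ler_ofR k) ofR_hnorm raddf0. Qed.

Lemma hnormD x y : hnorm (x + y) <= hnorm x + hnorm y.
Proof. by rewrite -(ler_ofR k) raddfD /= !ofR_hnorm ler_normD. Qed.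

Lemma hnormN x : hnorm (- x) = hnorm x.
Proof. by rewrite /hnorm normrN. Qed.

Lemma hnormB x y : hnorm (x - y) = hnorm (y - x).
Proof. by rewrite /hnorm distrC. Qed.

Lemma hnormZ a x : hnorm (a *: x) = smod a * hnorm x.
Proof. by rewrite {1}/hnorm normrZ -(ge0_sReK (normr_ge0 a)) sRe_ofRM ofRK. Qed.

Lemma hnorm0 : hnorm (0 : E) = 0.
Proof. by rewrite /hnorm normr0 raddf0. Qed.

Lemma hnorm0_eq0 x : hnorm x = 0 -> x = 0.
Proof. by move=> h; apply/normr0_eq0; rewrite -ofR_hnorm h raddf0. Qed.

Lemma le_dist_hnorm x y : `|hnorm x - hnorm y| <= hnorm (x - y).
Proof.
rewrite ler_norml; have := hnormD (x - y) y; have := hnormD (y - x) x.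
by rewrite !subrK (hnormB y); lra.
Qed.

(** A scalar that is positive for the order of [K] is the image of a positive
    real, so testing real radii is enough. *)
Lemma cvg_hnormP (T : Type) (F : set_system T) {FF : Filter F} (f : T -> E) x :
  f @ F --> x <-> forall e : R, 0 < e -> \forall t \near F, hnorm (x - f t) < e.
Proof.
split=> [/cvgrPdist_lt h e e0|h].
  have /h : 0 < emb e by rewrite -(raddf0 emb) ltr_ofR.
  by apply: filterS => t; rewrite -ofR_hnorm ltr_ofR.
apply/cvgrPdist_lt => e e0; rewrite -(ge0_sReK (ltW e0)).
have /h : 0 < sRe e by rewrite -(ltr_ofR k) ge0_sReK ?raddf0 // ltW.
by apply: filterS => t; rewrite -ofR_hnorm ltr_ofR.
Qed.

Lemma cvg_hnorm (T : Type) (F : set_system T) {FF : Filter F} (f : T -> E) x :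
  f @ F --> x -> hnorm (f t) @[t --> F] --> hnorm x.
Proof.
move=> /cvg_hnormP h; apply/cvgrPdist_lt => e /h.
by apply: filterS => t; apply: le_lt_trans; exact: le_dist_hnorm.
Qed.

Lemma cvg_uniq (T : Type) (F : set_system T) {FF : ProperFilter F} (f : T -> E) x y :
  f @ F --> x -> f @ F --> y -> x = y.
Proof. exact: (@norm_cvg_unique _ _ (f @ F)). Qed.

Lemma closure_hnormP (D : set E) x :
  closure D x <-> forall e : R, 0 < e -> exists2 y, D y & hnorm (x - y) < e.
Proof.
have nb := @cvg_hnormP E (nbhs x) _ id x.
split=> [h e e0|h B].
  have /nb/(_ _ e0) : id @ nbhs x --> x by [].
  by move=> /h[y [? ?]]; exists y.
rewrite -nbhs_ballE => -[e /= e0 eB].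
have re0 : 0 < sRe e by rewrite -(ltr_ofR k) ge0_sReK ?raddf0 // ltW.
have [y Dy xy] := h _ re0; exists y; split=> //; apply: eB.
by rewrite -ball_normE /= -ofR_hnorm -(ge0_sReK (ltW e0)) ltr_ofR.
Qed.

End Norm.

Section Scalars2.
Context (R : realType) (k : scalar_kind).
Local Notation K := (scalars R k).
Implicit Types x y : K.

Lemma smodM x y : smod (x * y) = smod x * smod y.
Proof. exact: (hnormZ x (y : K^o)). Qed.

Lemma sRe_mul_sconj x : sRe (sconj x * x) = smod x ^+ 2.
Proof. by rewrite mul_sconj -{1}(ge0_sReK (normr_ge0 x)) -rmorphXn /= ofRK. Qed.

Lemma smod_sconj x : smod (sconj x) = smod x.
Proof.
apply/eqP; rewrite -(@eqrXn2 _ 2) ?(hnorm_ge0 (_ : K^o)) //; apply/eqP.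
rewrite -!sRe_mul_sconj mulrC.
by rewrite (involutive_subproof : involutive (@sconj R k)).
Qed.

Lemma smod_ofR (a : R) : smod (ofR k a) = `|a|.
Proof.
case: (leP 0 a) => a0.
  have a0' : 0 <= ofR k a by rewrite -(raddf0 (@ofR R k)) ler_ofR.
  by rewrite (ger0_norm a0') (ger0_norm a0) ofRK.
have a0' : ofR k a <= 0 by rewrite -(raddf0 (@ofR R k)) ler_ofR ltW.
by rewrite (ler0_norm a0') (ler0_norm (ltW a0)) raddfN /= ofRK.
Qed.

(** The real part is 1-Lipschitz. *)
Lemma cvg_sRe (T : Type) (F : set_system T) {FF : Filter F} (u : T -> K^o) (l : K^o) :
  u @ F --> l -> sRe (u t) @[t --> F] --> sRe l.
Proof.
move=> /(@cvg_hnormP _ _ K^o) h; apply/cvgrPdist_lt => e /h.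
apply: filterS => t; apply: le_lt_trans; rewrite -raddfB /= ler_norml.
rewrite sRe_le_norm andbT lerNl -raddfN /=.
by rewrite (le_trans (sRe_le_norm _)) // normrN.
Qed.

End Scalars2.

Section Inner.
Context (R : realType) (k : scalar_kind).
Local Notation K := (scalars R k).
Local Notation emb := (@ofR R k).
Context (H : hilbertType R k).
Implicit Types (a : K) (x y z : H).

Lemma innerDr x y z : inner x (y + z) = inner x y + inner x z.
Proof. by rewrite /inner linearDl. Qed.
Lemma innerBr x y z : inner x (y - z) = inner x y - inner x z.
Proof. by rewrite /inner linearBl. Qed.
Lemma innerZr a x y : inner x (a *: y) = a * inner x y.
Proof. by rewrite /inner linearZl_LR. Qed.
Lemma innerDl x y z : inner (y + z) x = inner y x + inner z x.
Proof. by rewrite /inner linearDr. Qed.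
Lemma innerBl x y z : inner (y - z) x = inner y x - inner z x.
Proof. by rewrite /inner linearBr. Qed.
Lemma innerZl a x y : inner (a *: y) x = sconj a * inner y x.
Proof. by rewrite /inner linearZr_LR. Qed.
Lemma inner0r x : inner x 0 = 0.
Proof. by rewrite /inner linear0l. Qed.
Lemma inner0l x : inner 0 x = 0.
Proof. by rewrite /inner linear0r. Qed.

Lemma sconj_inner x y : sconj (inner x y) = inner y x.
Proof. by rewrite /inner [RHS](hermC _) expr0 mul1r. Qed.

Lemma inner_self x : inner x x = emb (hnorm x ^+ 2).
Proof. by rewrite /inner hdot_normE rmorphXn /= ofR_hnorm. Qed.

Lemma sRe_innerC x y : sRe (inner x y) = sRe (inner y x).
Proof. by rewrite -sconj_inner sRe_conj. Qed.

Lemma hnormD_sq x y :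
  hnorm (x + y) ^+ 2 = hnorm x ^+ 2 + 2 * sRe (inner x y) + hnorm y ^+ 2.
Proof.
rewrite -[LHS](ofRK k) -inner_self innerDl !innerDr !inner_self !raddfD /= !ofRK.
by rewrite (sRe_innerC y x); ring.
Qed.

Lemma hnormB_sq x y :
  hnorm (x - y) ^+ 2 = hnorm x ^+ 2 - 2 * sRe (inner x y) + hnorm y ^+ 2.
Proof.
rewrite hnormD_sq hnormN -scaleN1r innerZr mulN1r raddfN /=; ring.
Qed.

Lemma cauchy_schwarz x y : smod (inner x y) <= hnorm x * hnorm y.
Proof.
have [y0|y0] := eqVneq (hnorm y) 0.
  by rewrite (hnorm0_eq0 y0) inner0r normr0 raddf0 hnorm0 mulr0.
have yp : 0 < hnorm y by rewrite lt_def y0 hnorm_ge0.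
(* the squared distance from x to its projection on the line of y *)
have := sqr_ge0 (hnorm (x - (emb (hnorm y ^- 2) * sconj (inner x y)) *: y)).
rewrite hnormB_sq innerZr -mulrA sRe_ofRM sRe_mul_sconj hnormZ smodM smod_sconj.
rewrite smod_ofR (ger0_norm (_ : 0 <= _ ^- 2)) ?invr_ge0 ?sqr_ge0 //.
set n := hnorm y in y0 yp *; set m := smod (inner x y).
have -> : hnorm x ^+ 2 - 2 * (n ^- 2 * m ^+ 2) + (n ^- 2 * m * n) ^+ 2
   = (hnorm x ^+ 2 * n ^+ 2 - m ^+ 2) / n ^+ 2 by field.
rewrite pmulr_lge0 ?invr_gt0 ?exprn_gt0 // subr_ge0 -exprMn.
by rewrite ler_pXn2r // ?nnegrE ?mulr_ge0 ?hnorm_ge0 // (hnorm_ge0 (_ : K^o)).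
Qed.

Lemma sRe_inner_le x y : sRe (inner x y) <= hnorm x * hnorm y.
Proof. exact: le_trans (sRe_le_norm _) (cauchy_schwarz x y). Qed.

Lemma inner_eq0 x : (forall y, inner x y = 0) -> x = 0.
Proof.
move=> /(_ x); rewrite inner_self -(raddf0 emb) => /(can_inj (ofRK k)) /eqP.
by rewrite sqrf_eq0 => /eqP /hnorm0_eq0.
Qed.

Lemma inner_ext x y : (forall z, inner x z = inner y z) -> x = y.
Proof.
by move=> h; apply/eqP; rewrite -subr_eq0; apply/eqP/inner_eq0 => z;
  rewrite innerBl h subrr.
Qed.

Lemma cvg_innerr (T : Type) (F : set_system T) {FF : Filter F} (f : T -> H) x y :
  f @ F --> x -> (inner y (f t) : K^o) @[t --> F] --> (inner y x : K^o).
Proof.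
move=> /cvg_hnormP h; apply/(@cvg_hnormP _ _ K^o) => e e0.
have p : 0 < hnorm y + 1 by rewrite ltr_wpDl ?hnorm_ge0.
have /h : 0 < e / (hnorm y + 1) by rewrite divr_gt0.
apply: filterS => t; rewrite ltr_pdivlMr // => he.
rewrite /hnorm -innerBr (le_lt_trans (cauchy_schwarz _ _)) // (le_lt_trans _ he) //.
by rewrite mulrC ler_wpM2l ?hnorm_ge0 // lerDl.
Qed.

Lemma cvg_innerl (T : Type) (F : set_system T) {FF : Filter F} (f : T -> H) x y :
  f @ F --> x -> (inner (f t) y : K^o) @[t --> F] --> (inner x y : K^o).
Proof.
move=> /(cvg_innerr (y := y)) /(@cvg_hnormP _ _ K^o) h.
apply/(@cvg_hnormP _ _ K^o) => e /h; apply: filterS => t.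
by rewrite /hnorm -smod_sconj raddfB /= !sconj_inner.
Qed.

Lemma parallelogram x y :
  hnorm (x + y) ^+ 2 + hnorm (x - y) ^+ 2 = 2 * (hnorm x ^+ 2 + hnorm y ^+ 2).
Proof. by rewrite hnormD_sq hnormB_sq; ring. Qed.

End Inner.

(** * The Riesz representation theorem and orthogonal decompositions *)

Section Complete.
Context (R : realType) (k : scalar_kind).
Local Notation K := (scalars R k).
Local Notation emb := (@ofR R k).
Context (H : hilbertType R k).
Implicit Types (x y z : H) (D : set H).

(** The point near which [f] eventually stays may depend on [e], so no limit has
    to be guessed; this serves both sequences and nets over finite sets. *)
Lemma cauchy_hnorm_cvg (T : Type) (F : set_system T) {FF : ProperFilter F}
    (f : T -> H) :
  (forall e : R, 0 < e -> exists x, \forall t \near F, hnorm (x - f t) < e) ->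
  exists l : H, f @ F --> l.
Proof.
move=> h; suff /cvg_ex[l fl] : [cvg (f @ F) in H] by exists l.
apply: cauchy_cvg; apply: cauchy_exP => e e0.
have re0 : 0 < sRe e by rewrite -(ltr_ofR k) ge0_sReK ?raddf0 // ltW.
have [x hx] := h _ re0; exists x; near=> t.
rewrite -ball_normE /= -ofR_hnorm -(ge0_sReK (ltW e0)) ltr_ofR.
by near: t.
Unshelve. all: end_near.
Qed.

Definition subspace D :=
  D 0 /\ forall (a : K) x y, D x -> D y -> D (a *: x + y).

Lemma subspaceZ D a x : subspace D -> D x -> D (a *: x).
Proof. by move=> [D0 DD] Dx; rewrite -[_ *: _]addr0; exact: DD. Qed.

Lemma subspaceD D x y : subspace D -> D x -> D y -> D (x + y).
Proof. by move=> [D0 DD] Dx Dy; rewrite -[x]scale1r; exact: DD. Qed.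

Lemma subspaceB D x y : subspace D -> D x -> D y -> D (x - y).
Proof.
by move=> sD Dx Dy; rewrite -scaleN1r; apply: subspaceD=> //; apply: subspaceZ.
Qed.

(** Multiplying by the conjugate of [a - b] recovers its modulus, so real parts
    see all of a scalar in both the real and the complex case. *)
Lemma sRe_mul_inj (a b : K) : (forall c, sRe (c * a) = sRe (c * b)) -> a = b.
Proof.
move=> h; apply/eqP; rewrite -subr_eq0; apply/eqP/(@hnorm0_eq0 _ _ K^o).
apply/eqP; rewrite -sqrf_eq0 -sRe_mul_sconj.
by rewrite mulrBr raddfB /= h subrr.
Qed.

(** The functional lives on [D] alone, which need not be closed: a minimising
    sequence of [|x|^2 - 2 Re (phi x)] in [D] is Cauchy by the parallelogram law,
    and the first variation at its limit [w] is the required identity.  The limit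
    itself may leave [D], where [phi] is meaningless, so the variation is
    computed along the sequence. *)
Lemma riesz D (phi : H -> K) (C : R) : subspace D ->
  (forall (a : K) x y, D x -> D y -> phi (a *: x + y) = a * phi x + phi y) ->
  (forall x, D x -> smod (phi x) <= C * hnorm x) ->
  exists2 w, closure D w & forall x, D x -> inner w x = phi x.
Proof.
move=> sD philin phiC.
have D0 : D 0 by case: sD.
have phi0 : phi 0 = 0.
  by have := philin (-1) 0 0 D0 D0; rewrite scaler0 addr0 mulN1r addNr.
have phiZ a x : D x -> phi (a *: x) = a * phi x.
  by move=> Dx; rewrite -[a *: x]addr0 philin // phi0 addr0.
have phiD x y : D x -> D y -> phi (x + y) = phi x + phi y.
  by move=> Dx Dy; rewrite -{1}[x]scale1r philin // mul1r.
pose J x := hnorm x ^+ 2 - 2 * sRe (phi x).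
have Jlb x : D x -> - C ^+ 2 <= J x.
  move=> Dx; have := phiC _ Dx; have := sRe_le_norm (phi x).
  have := sqr_ge0 (hnorm x - C); rewrite /J.
  set n := hnorm x; set p := sRe _; set q := smod _; nra.
have hasJ : has_inf (J @` D).
  split; first by exists (J 0), 0.
  by exists (- C ^+ 2) => _ [x Dx <-]; exact: Jlb.
pose m := inf (J @` D).
have mJ x : D x -> m <= J x.
  by move=> Dx; apply: ge_inf; [case: hasJ | exists x].
have /choice[y hy] : forall n, exists x, D x /\ J x < m + n.+1%:R^-1.
  move=> n; have n0 : 0 < n.+1%:R^-1 :> R by rewrite invr_gt0.
  by have [_ [x Dx <-] Jx] := inf_adherent n0 hasJ; exists x.
(* the midpoint of x and z lies in D, so J is at least m there *)
have Jmid x z : D x -> D z -> hnorm (x - z) ^+ 2 <= 2 * (J x - m) + 2 * (J z - m).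
  move=> Dx Dz; have Dxz := subspaceD sD Dx Dz.
  have := mJ _ (subspaceZ (emb 2^-1) sD Dxz).
  have := parallelogram x z; rewrite /J phiZ // phiD // sRe_ofRM (raddfD (@sRe R k)) /=.
  rewrite hnormZ smod_ofR ger0_norm // exprMn.
  set a := hnorm (x + z) ^+ 2; set b := hnorm (x - z) ^+ 2.
  lra.
have [w yw] : exists w : H, y n @[n --> \oo] --> w.
  apply: cauchy_hnorm_cvg => e e0.
  have d0 : 0 < e ^+ 2 / 4 by rewrite divr_gt0 // exprn_gt0.
  have [N _ hN] := near_infty_natSinv_lt (PosNum d0).
  exists (y N); exists N => // n /hN /= nd.
  have /= Nd := hN N (leqnn N).
  rewrite -(@ltr_pXn2r _ 2) ?nnegrE ?hnorm_ge0 ?(ltW e0) //.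
  have [[DN JN] [Dn Jn]] := (hy N, hy n).
  apply: le_lt_trans (Jmid _ _ DN Dn) _.
  move: nd Nd JN Jn; set u := n.+1%:R^-1; set u' := N.+1%:R^-1.
  lra.
exists w.
  apply/closure_hnormP => e /((cvg_hnormP _ _).1 yw) [N _ /(_ _ (leqnn N)) h].
  by exists (y N) => //; case: (hy N).
(* J (y n + t z) >= m for all real t; in the limit this is a nonnegative quadratic
   in t whose linear coefficient must vanish *)
have re_eq z : D z -> sRe (inner w z) = sRe (phi z).
  move=> Dz; pose r n := sRe (inner (y n) z) - sRe (phi z).
  have rcv : r n @[n --> \oo] --> sRe (inner w z) - sRe (phi z).
    apply: cvgB; last exact: cvg_cst.
    by apply: cvg_sRe; exact: cvg_innerl.
  have quad t : 0 <= 2 * t * (sRe (inner w z) - sRe (phi z))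
                    + t ^+ 2 * hnorm z ^+ 2.
    suff /cvgr_to_ge : (2 * t * r n + t ^+ 2 * hnorm z ^+ 2 + n.+1%:R^-1)
       @[n --> \oo] --> 2 * t * (sRe (inner w z) - sRe (phi z))
                    + t ^+ 2 * hnorm z ^+ 2 + 0.
      rewrite addr0; apply; near=> n.
      have [Dn Jn] := hy n.
      have := mJ _ (subspaceD sD Dn (subspaceZ (emb t) sD Dz)).
      move: Jn; rewrite /J phiD // ?phiZ //; last exact: subspaceZ.
      rewrite hnormD_sq innerZr (raddfD (@sRe R k)) /= !sRe_ofRM hnormZ smod_ofR exprMn.
      rewrite real_normK ?num_real // /r; set u := n.+1%:R^-1; lra.
    apply: cvgD; last exact: cvg_harmonic.
    apply: cvgD; last exact: cvg_cst.
    by apply: cvgM => //; exact: cvg_cst.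
  set r0 := sRe (inner w z) - sRe (phi z) in quad; apply/eqP; rewrite -subr_eq0 -/r0.
  set q := hnorm z ^+ 2 in quad.
  have q1 : 0 < q + 1 by rewrite ltr_wpDl ?sqr_ge0.
  (* the minimiser - r0 / q, shifted because q may be 0 *)
  have := quad (- r0 / (q + 1)).
  have -> : 2 * (- r0 / (q + 1)) * r0 + (- r0 / (q + 1)) ^+ 2 * q
     = - (r0 ^+ 2 * ((q + 2) / (q + 1) ^+ 2)).
    by field; rewrite gt_eqF.
  rewrite oppr_ge0 pmulr_lle0.
    by move=> h; rewrite -sqrf_eq0 eq_le h sqr_ge0.
  by rewrite divr_gt0 ?exprn_gt0 // ltr_wpDl ?sqr_ge0.
move=> x Dx; apply: sRe_mul_inj => c.
by rewrite -innerZr -phiZ // re_eq //; exact: subspaceZ.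
Unshelve. all: end_near.
Qed.

Lemma closure_subspace D : subspace D -> subspace (closure D).
Proof.
move=> [D0 DD]; split; first exact: subset_closure.
move=> a x y /closure_hnormP hx /closure_hnormP hy; apply/closure_hnormP => e e0.
have a0 : 0 <= smod a by exact: (hnorm_ge0 (a : K^o)).
have p : 0 < smod a + 1 by rewrite ltr_wpDl.
have /hx[x' Dx' xx'] : 0 < e / (2 * (smod a + 1)) by rewrite divr_gt0 // mulr_gt0.
have /hy[y' Dy' yy'] : 0 < e / 2 by rewrite divr_gt0.
exists (a *: x' + y'); first exact: DD.
rewrite opprD addrACA -scalerBr (le_lt_trans (hnormD _ _)) // hnormZ.
move: xx'; rewrite ltr_pdivlMr ?mulr_gt0 //.
have := hnorm_ge0 (x - x'); move: yy' a0; set u := hnorm (x - x'); set c := smod a.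
nra.
Qed.

Lemma orthogonal_closure D z :
  (forall x, D x -> inner z x = 0) -> forall x, closure D x -> inner z x = 0.
Proof.
move=> h x /closure_hnormP hx; apply/(@hnorm0_eq0 _ _ K^o).
apply/eqP; rewrite eq_le (hnorm_ge0 (_ : K^o)) andbT.
apply/ler_addgt0Pl => e e0; rewrite addr0.
have p : 0 < hnorm z + 1 by rewrite ltr_wpDl ?hnorm_ge0.
have /hx[y Dy] : 0 < e / (hnorm z + 1) by rewrite divr_gt0.
rewrite ltr_pdivlMr // => /ltW; apply: le_trans.
rewrite -[inner z x]subr0 -(h _ Dy) -innerBr (le_trans (cauchy_schwarz _ _)) //.
by rewrite mulrC ler_wpM2l ?hnorm_ge0 // lerDl.
Qed.

(** Riesz applied to [<x | .>] produces the orthogonal projection of [x]. *)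
Lemma orthogonal_decomposition D x : subspace D ->
  exists2 p, closure D p & forall y, closure D y -> inner (x - p) y = 0.
Proof.
move=> sD; have [||p Dp hp] := @riesz D (inner x) (hnorm x) sD.
- by move=> a y z _ _; rewrite innerDr innerZr.
- by move=> y _; exact: cauchy_schwarz.
exists p => //; apply: orthogonal_closure => y Dy.
by rewrite innerBl hp // subrr.
Qed.

End Complete.

(** * Square roots of positive operators *)

Section SquareRoot.
Context (R : realType) (k : scalar_kind).
Local Notation K := (scalars R k).
Local Notation emb := (@ofR R k).
Context (H : hilbertType R k).
Implicit Types (x y z : H).

Section LinearMaps.
Variables (T : H -> H) (linT : linear T).

Lemma lin0 : T 0 = 0.
Proof. by have := linT (-1) 0 0; rewrite scaler0 addr0 scaleN1r addNr. Qed.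

Lemma linZ a x : T (a *: x) = a *: T x.
Proof. by rewrite -[a *: x]addr0 linT lin0 addr0. Qed.

Lemma linD x y : T (x + y) = T x + T y.
Proof. by rewrite -{1}[x]scale1r linT scale1r. Qed.

Lemma linB x y : T (x - y) = T x - T y.
Proof. by rewrite -scaleN1r linD linZ scaleN1r. Qed.

Lemma linear_bounded_continuous (M : R) :
  (forall x, hnorm (T x) <= M * hnorm x) -> continuous T.
Proof.
move=> TM x; apply/cvg_hnormP => e e0.
have p : 0 < `|M| + 1 by rewrite ltr_wpDl.
have /cvg_hnormP near_x : (id : H -> H) y @[y --> x] --> x by exact: cvg_id.
have /near_x : 0 < e / (`|M| + 1) by rewrite divr_gt0.
apply: filterS => y; rewrite ltr_pdivlMr // => he.
rewrite -linB (le_lt_trans (TM _)) // (le_lt_trans _ he) //.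
rewrite mulrC ler_wpM2l ?hnorm_ge0 // (le_trans (ler_norm _)) // lerDl //.
Qed.

End LinearMaps.

Section Contraction.
Variables (B : H -> H) (Blin : linear B).
Hypothesis symB : forall x y, inner x (B y) = inner (B x) y.
Hypothesis ctrB : forall x, hnorm (B x) <= hnorm x.

(** Iterating [Y = (B + Y^2) / 2]; a fixed point satisfies [(1 - Y)^2 = 1 - B]. *)
Fixpoint sq_iter n x : H :=
  if n is m.+1 then emb 2^-1 *: (B x + sq_iter m (sq_iter m x)) else 0.

(** The same recursion for the number 1 in place of [B]: since [sq_iter n] is a
    polynomial in [B] with nonnegative coefficients, of sum [sq_bound n], this
    number bounds its operator norm. *)
Fixpoint sq_bound n : R := if n is m.+1 then (1 + sq_bound m ^+ 2) / 2 else 0.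

Lemma sq_iter_linear n : linear (sq_iter n).
Proof.
elim: n => [|n IH] a x y /=; first by rewrite scaler0 addr0.
by rewrite Blin !IH addrACA -scalerDr [LHS]scalerDr !scalerA [in LHS]mulrC.
Qed.

(** Taking first [C = B], then [C] another iterate, this makes all iterates
    commute ([sq_iter_commute]). *)
Lemma sq_iter_comm n (C : H -> H) : linear C -> (forall x, C (B x) = B (C x)) ->
  forall x, C (sq_iter n x) = sq_iter n (C x).
Proof.
move=> linC CB; elim: n => [|n IH] x /=; first exact: lin0.
by rewrite linZ // linD // CB !IH.
Qed.

Lemma sq_iter_commute m n x :
  sq_iter m (sq_iter n x) = sq_iter n (sq_iter m x).
Proof.
apply: sq_iter_comm => [|y]; first exact: sq_iter_linear.
by rewrite (sq_iter_comm m Blin).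
Qed.

Lemma sq_iter_sym n x y : inner x (sq_iter n y) = inner (sq_iter n x) y.
Proof.
elim: n x y => [|n IH] x y /=; first by rewrite inner0l inner0r.
by rewrite innerZr innerZl sconj_ofR innerDr innerDl symB !IH.
Qed.

Lemma sq_bound_ge0 n : 0 <= sq_bound n.
Proof. by case: n => //= n; rewrite divr_ge0 // addr_ge0 // sqr_ge0. Qed.

Lemma sq_bound_le1 n : sq_bound n <= 1.
Proof. by elim: n => //= n IH; have := sq_bound_ge0 n; nra. Qed.

Lemma sq_bound_nondecreasing n : sq_bound n <= sq_bound n.+1.
Proof. by have := sqr_ge0 (1 - sq_bound n); rewrite /=; nra. Qed.

Lemma hnorm_half x : hnorm (emb 2^-1 *: x) = hnorm x / 2.
Proof. by rewrite hnormZ smod_ofR ger0_norm // mulrC. Qed.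

Lemma sq_iter_le n x : hnorm (sq_iter n x) <= sq_bound n * hnorm x.
Proof.
elim: n x => [|n IH] x /=; first by rewrite hnorm0 mul0r.
rewrite hnorm_half mulrAC ler_pM2r // (le_trans (hnormD _ _)) //.
rewrite mulrDl mul1r lerD // expr2 -mulrA (le_trans (IH _)) //.
by rewrite ler_wpM2l ?sq_bound_ge0.
Qed.

(** For commuting [Y] and [Z], [Y^2 - Z^2 = (Y - Z) (Y + Z)]: an increment of the
    iteration is half the previous increment applied to a sum of iterates, and
    the real bounds satisfy the same recursion exactly. *)
Lemma sq_iter_step n x :
  hnorm (sq_iter n.+1 x - sq_iter n x)
    <= (sq_bound n.+1 - sq_bound n) * hnorm x.
Proof.
elim: n x => [|n IH] x.
  rewrite /= !subr0 !addr0 hnorm_half expr0n /= addr0 mul1r mulrC.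
  by rewrite ler_pM2l.
(* the difference of squares, factored *)
pose Y := sq_iter n; pose Y' := sq_iter n.+1.
have -> : sq_iter n.+2 x - Y' x =
    emb 2^-1 *: (Y' (Y' x + Y x) - Y (Y' x + Y x)).
  have E1 : sq_iter n.+2 x = emb 2^-1 *: (B x + Y' (Y' x)) by [].
  have E2 : Y' x = emb 2^-1 *: (B x + Y (Y x)) by [].
  rewrite E1 [X in _ - X = _]E2 -scalerBr.
  congr (_ *: _); rewrite (linD (sq_iter_linear n.+1 : linear Y')).
  rewrite (linD (sq_iter_linear n : linear Y)).
  rewrite [Y (Y' x)](sq_iter_commute n n.+1) -/Y -/Y' opprD addrACA.
  by rewrite [B x - B x]subrr add0r opprD addrA addrK.
rewrite hnorm_half.
have := IH (Y' x + Y x); have := hnormD (Y' x) (Y x).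
have := sq_iter_le n.+1 x; have := sq_iter_le n x.
have := sq_bound_nondecreasing n; rewrite -/Y -/Y' [sq_bound n.+2]/=.
have := hnorm_ge0 x.
have : sq_bound n.+1 = (1 + sq_bound n ^+ 2) / 2 by [].
set t := sq_bound n.+1; set s := sq_bound n; set a := hnorm x.
set b := hnorm (Y x); set c := hnorm (Y' x); set d := hnorm (Y' x + Y x).
set e := hnorm _ => ts a0 st bs ct dbc ed.
have h : (t - s) * d <= (t - s) * ((t + s) * a).
  by apply: ler_wpM2l; lra.
rewrite ler_pdivrMr //; apply: (le_trans ed); apply: (le_trans h).
have s2 : s ^+ 2 = 2 * t - 1 by rewrite ts; field.
have -> : (t - s) * ((t + s) * a) = (t ^+ 2 - s ^+ 2) * a by ring.
by rewrite s2 le_eqVlt; apply/orP; left; apply/eqP; field.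
Qed.

Lemma sq_iter_dist m n x : (n <= m)%N ->
  hnorm (sq_iter m x - sq_iter n x) <= (sq_bound m - sq_bound n) * hnorm x.
Proof.
move=> /subnK <-; elim: (m - n)%N => [|i IH].
  by rewrite !subrr hnorm0 mul0r.
rewrite addSn -(subrKA (sq_iter (i + n) x)) (le_trans (hnormD _ _)) //.
rewrite -(subrKA (sq_bound (i + n)) (sq_bound (i + n).+1)) mulrDl lerD //.
exact: sq_iter_step.
Qed.

(** The increasing sequence [sq_bound] is bounded by 1, and dominates the
    distances between iterates. *)
Lemma sq_iter_cvg x : exists y : H, sq_iter n x @[n --> \oo] --> y.
Proof.
apply: cauchy_hnorm_cvg => e e0.
have homo_t : {homo sq_bound : n m / (n <= m)%N >-> n <= m}.
  by apply: homo_leq => // [a b c|]; [exact: le_trans|exact: sq_bound_nondecreasing].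
have ub_t : has_ubound (range sq_bound).
  by exists 1 => _ [n _ <-]; exact: sq_bound_le1.
pose L := sup (range sq_bound).
have tL n : sq_bound n <= L by apply: ub_le_sup => //; exists n.
have p : 0 < hnorm x + 1 by rewrite ltr_wpDl ?hnorm_ge0.
have [_ [N _ <-] hN] : exists2 t, range sq_bound t & L - e / (hnorm x + 1) < t.
  apply: sup_adherent; first by rewrite divr_gt0.
  by split=> //; exists (sq_bound 0), 0.
exists (sq_iter N x); exists N => // n /= Nn.
rewrite hnormB (le_lt_trans (sq_iter_dist _ Nn)) //.
have : sq_bound n - sq_bound N < e / (hnorm x + 1).
  by rewrite (le_lt_trans (lerB (tL n) (lexx _))) // ltrBlDr -ltrBlDl.
rewrite ltr_pdivlMr // => h; rewrite (le_lt_trans _ h) //.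
by rewrite ler_wpM2l ?subr_ge0 ?homo_t // lerDl.
Qed.

(** The square root of [1 - B] is [1 - Y], positive because [Y] is a symmetric
    contraction. *)
Lemma contraction_sqrt : exists T : H -> H,
  [/\ linear T, forall x, hnorm (T x) <= 2 * hnorm x,
      forall x y, inner x (T y) = inner (T x) y,
      forall x, 0 <= inner x (T x) &
      forall x, T (T x) = x - B x].
Proof.
have [Y hY] := choice sq_iter_cvg.
have Ylin : linear Y.
  move=> a x y; apply: (cvg_uniq (hY _)).
  under eq_cvg do rewrite sq_iter_linear.
  by apply: cvgD; [apply: cvgZr; exact: hY | exact: hY].
have Ysym x y : inner x (Y y) = inner (Y x) y.
  apply: (cvg_uniq (cvg_innerr (hY y))).
  under eq_cvg do rewrite sq_iter_sym.
  exact: cvg_innerl (hY x).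
have Yctr x : hnorm (Y x) <= hnorm x.
  apply: (@cvgr_to_le _ _ _ _ _ _ _ (cvg_hnorm (hY x))).
  near=> n; rewrite (le_trans (sq_iter_le _ _)) //.
  by rewrite ler_piMl ?hnorm_ge0 ?sq_bound_le1.
(* the recursion passes to the limit since the iterates are equicontinuous *)
have Yfix x : Y x = emb 2^-1 *: (B x + Y (Y x)).
  have hS : sq_iter n.+1 x @[n --> \oo] --> Y x.
    by have := hY x; rewrite -(cvg_shiftS (fun n => sq_iter n x)).
  apply: (cvg_uniq hS); rewrite /=; apply: cvgZr; apply: cvgD; first exact: cvg_cst.
  apply/cvg_hnormP => e e0; have e20 : 0 < e / 2 by rewrite divr_gt0.
  have /cvg_hnormP/(_ _ e20) := hY x; have /cvg_hnormP/(_ _ e20) := hY (Y x).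
  apply: filterS2 => n h1 h2.
  rewrite -(subrKA (sq_iter n (Y x))) (le_lt_trans (hnormD _ _)) // [ltRHS]splitr.
  rewrite ltrD // -(linB (sq_iter_linear n)) (le_lt_trans (sq_iter_le _ _)) //.
  rewrite (le_lt_trans _ h2) // ler_piMl ?hnorm_ge0 //; exact: sq_bound_le1.
exists (fun x => x - Y x); split.
- by move=> a x y; rewrite Ylin scalerBr opprD addrACA.
- by move=> x; rewrite (le_trans (hnormD _ _)) // hnormN; have := Yctr x; lra.
- by move=> x y; rewrite innerBl innerBr Ysym.
- move=> x; rewrite -(@sconj_fixed _ _ (inner x _)).
    rewrite -(raddf0 emb) ler_ofR innerBr inner_self raddfB /= ofRK subr_ge0.
    by rewrite expr2 (le_trans (sRe_inner_le _ _)) // ler_wpM2l ?hnorm_ge0.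
  by rewrite sconj_inner innerBl innerBr Ysym.
- move=> x; rewrite (linB Ylin).
  have : B x + Y (Y x) = emb 2 *: Y x.
    by rewrite [in RHS]Yfix scalerA -rmorphM /= divff // rmorph1 scale1r.
  move=> /eqP; rewrite eq_sym -subr_eq => /eqP <-.
  rewrite rmorphD rmorph1 scalerDl scale1r.
  set y := Y x; set z := Y y.
  by rewrite !opprD !opprK -!addrA; congr (_ + _); rewrite addrC -!addrA.
Unshelve. all: end_near.
Qed.

End Contraction.

(** The last hypothesis is what makes [1 - P / c] a contraction; it also forces
    [<x | P x>] to have nonnegative real part. *)
Lemma exists_sqrt (P : H -> H) (c : R) : 0 < c -> linear P ->
  (forall x y, inner x (P y) = inner (P x) y) ->
  (forall x, hnorm (P x) ^+ 2 <= c * sRe (inner x (P x))) ->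
  exists T, is_sqrt_operator P T.
Proof.
move=> c0 Plin Psym Pc.
pose B x := x - emb c^-1 *: P x.
have Blin : linear B.
  move=> a x y; rewrite /B Plin scalerDr scalerBr opprD addrACA.
  by rewrite !scalerA mulrC.
have Bsym x y : inner x (B y) = inner (B x) y.
  by rewrite /B innerBr innerBl innerZr innerZl sconj_ofR Psym.
have Bctr x : hnorm (B x) <= hnorm x.
  rewrite -(@ler_pXn2r _ 2) ?nnegrE ?hnorm_ge0 // hnormB_sq innerZr sRe_ofRM.
  rewrite hnormZ smod_ofR ger0_norm ?invr_ge0 ?(ltW c0) // exprMn.
  have := Pc x; set p := hnorm (P x) ^+ 2; set q := sRe _ => pq.
  have p0 : 0 <= p by exact: sqr_ge0.
  have h : c^-1 * p <= q by rewrite ler_pdivrMl.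
  have ci : 0 < c^-1 by rewrite invr_gt0.
  have q0 : 0 <= q by apply: le_trans h; rewrite mulr_ge0 // ltW.
  have -> : c^-1 ^+ 2 * p = c^-1 * (c^-1 * p) by rewrite mulrA.
  have h2 : c^-1 * (c^-1 * p) <= c^-1 * q by rewrite ler_wpM2l // ltW.
  have h3 : 0 <= c^-1 * q by rewrite mulr_ge0 // ltW.
  move: h2 h3; set u := c^-1 * q; set t := c^-1 * _; lra.
have [T [Tlin Tb Tsym Tpos TT]] := contraction_sqrt Blin Bsym Bctr.
exists (fun x => emb (Num.sqrt c) *: T x); split; [split|].
- by move=> a x y; rewrite Tlin scalerDr !scalerA mulrC.
- apply: (@linear_bounded_continuous _ _ (Num.sqrt c * 2)).
    by move=> a x y; rewrite Tlin scalerDr !scalerA mulrC.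
  move=> x; rewrite hnormZ smod_ofR ger0_norm ?sqrtr_ge0 // -mulrA.
  by rewrite ler_wpM2l ?sqrtr_ge0.
- by move=> x y; rewrite innerZr innerZl sconj_ofR Tsym.
- move=> x; rewrite innerZr mulr_ge0 //.
  by rewrite -(raddf0 emb) ler_ofR sqrtr_ge0.
- apply/funext => x /=; rewrite (linZ Tlin) scalerA -rmorphM /= -expr2.
  rewrite sqr_sqrtr ?(ltW c0) // TT /B opprB addrC subrK scalerA -rmorphM /=.
  by rewrite divff ?gt_eqF // rmorph1 scale1r.
Qed.

End SquareRoot.

(** * Square sums and the frame operator *)

#[local] Existing Instance totally_filter.

Section Sums.
Context (R : realType) (k : scalar_kind) (S : countType) (H : hilbertType R k).
Local Notation K := (scalars R k).
Local Notation emb := (@ofR R k).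
Implicit Types (F G : {fset S}) (xi : S -> K).

Lemma partial_sumE (V : zmodType) (x : S -> V) F :
  partial_sum x F = \sum_(s <- F) x s.
Proof. by rewrite /partial_sum big_seq_fsetE. Qed.

Lemma sqsum_leP xi (a : R) :
  (sqsum xi <= a%:E)%E <-> forall F, \sum_(s <- F) smod (xi s) ^+ 2 <= a.
Proof.
split=> [h F|h].
  rewrite -lee_fin; apply: le_trans h; apply: esum_ge; exists [set` F].
    by split=> //; exact: finite_fset.
  by rewrite fsbig_finite ?finite_fset // set_fsetK sumEFin.
apply: ge_ereal_sup => _ [X [finX _] <-].
by rewrite fsbig_finite // sumEFin lee_fin.
Qed.

Lemma sum_fset_split (V : zmodType) (x : S -> V) F G : (F `<=` G)%fset ->
  \sum_(s <- G) x s = \sum_(s <- F) x s + \sum_(s <- (G `\` F)%fset) x s.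
Proof.
move=> FG; rewrite (big_fsetID _ (mem F)) /=; congr (_ + _); apply: eq_fbigl.
  by move=> s; rewrite !inE /= andbC; case: (boolP (s \in F)) => // /(fsubsetP FG).
by move=> s; rewrite !inE /= andbC.
Qed.

Lemma ler_sum_fset (x : S -> R) F G : (forall s, 0 <= x s) -> (F `<=` G)%fset ->
  \sum_(s <- F) x s <= \sum_(s <- G) x s.
Proof. by move=> x0 /sum_fset_split ->; rewrite lerDl sumr_ge0. Qed.

Lemma near_totally F : \forall G \near totally, (F `<=` G)%fset.
Proof. by exists F. Qed.

(** Sums of nonnegative terms increase along finite subsets, so their limit is
    their supremum. *)
Lemma sqsum_cvg xi (a : R) :
  partial_sum (fun s => smod (xi s) ^+ 2) @ totally --> a -> sqsum xi = a%:E.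
Proof.
move=> h; have ge0 s : 0 <= smod (xi s) ^+ 2 by exact: sqr_ge0.
have le_a F : \sum_(s <- F) smod (xi s) ^+ 2 <= a.
  apply: (cvgr_to_ge h); near=> G; rewrite partial_sumE; apply: ler_sum_fset => //.
  by near: G; exact: near_totally.
have fin : sqsum xi \is a fin_num.
  rewrite ge0_fin_numE; last by apply: esum_ge0 => s _; rewrite lee_fin.
  by rewrite (le_lt_trans _ (ltry a)) //; apply/sqsum_leP.
rewrite -(fineK fin); congr EFin; apply/eqP; rewrite eq_le -lee_fin fineK //.
apply/andP; split; first exact/sqsum_leP.
apply: (cvgr_to_le h); near=> F; rewrite partial_sumE.
have : (sqsum xi <= (fine (sqsum xi))%:E)%E by rewrite fineK.
by move=> /sqsum_leP.
Unshelve. all: end_near.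
Qed.

Section Bessel.
Variables (v : S -> H) (c : R) (c0 : 0 < c) (bv : bessel v c).

Lemma bessel_fset f F :
  \sum_(s <- F) smod (inner (v s) f) ^+ 2 <= c * hnorm f ^+ 2.
Proof. exact: (sqsum_leP (analysis v f) _).1 (bv f) F. Qed.

Lemma inner_sumr x (r : seq S) (y : S -> H) :
  inner x (\sum_(s <- r) y s) = \sum_(s <- r) inner x (y s).
Proof.
elim/big_rec2 : _ => [|s a b _ <-]; first exact: inner0r.
by rewrite innerDr.
Qed.

Lemma inner_suml x (r : seq S) (y : S -> H) :
  inner (\sum_(s <- r) y s) x = \sum_(s <- r) inner (y s) x.
Proof.
elim/big_rec2 : _ => [|s a b _ <-]; first exact: inner0l.
by rewrite innerDl.
Qed.

(** For [y] the sum on the left, [|y|^2 = Re (sum of xi_s <y | v s>)] is at most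
    half of [c |xi|^2 + c^-1 (sum of |<v s | y>|^2)], and the Bessel inequality
    for [y] absorbs the second term. *)
Lemma synthesis_bound xi F :
  hnorm (\sum_(s <- F) xi s *: v s) ^+ 2 <= c * \sum_(s <- F) smod (xi s) ^+ 2.
Proof.
set y := \sum_(s <- F) _; set q := \sum_(s <- F) _.
suff : hnorm y ^+ 2 <= 2^-1 * (c * q) + 2^-1 * (c^-1 * (c * hnorm y ^+ 2)).
  by rewrite (mulrA c^-1) mulVf ?gt_eqF // mul1r; lra.
have h : hnorm y ^+ 2 <=
    2^-1 * (c * q) + 2^-1 * (c^-1 * \sum_(s <- F) smod (inner (v s) y) ^+ 2).
  rewrite -[leLHS](ofRK k) -inner_self {2}/y inner_sumr raddf_sum /=.
  rewrite /q !mulr_sumr -big_split /=; apply: ler_sum => s _.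
  rewrite innerZr (le_trans (sRe_le_norm _)) // smodM.
  rewrite -(smod_sconj (inner y _)) sconj_inner.
  set a := smod (xi s); set b := smod _; rewrite -subr_ge0.
  have -> : 2^-1 * (c * a ^+ 2) + 2^-1 * (c^-1 * b ^+ 2) - a * b
     = 2^-1 * c^-1 * (c * a - b) ^+ 2 by field; rewrite gt_eqF.
  by rewrite mulr_ge0 ?sqr_ge0 // mulr_ge0 // invr_ge0 ltW.
apply: (le_trans h); rewrite lerD2l ler_wpM2l // ler_wpM2l ?invr_ge0 ?(ltW c0) //.
exact: bessel_fset.
Qed.

(** The terms outside a large finite set carry little of the square sum, so
    [synthesis_bound] makes the finite sums a Cauchy net. *)
Lemma synthesis_cvg xi (M : R) :
  (forall F, \sum_(s <- F) smod (xi s) ^+ 2 <= M) ->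
  exists y : H, partial_sum (fun s => xi s *: v s) @ totally --> y.
Proof.
move=> hM; apply: cauchy_hnorm_cvg => e e0.
pose q F := \sum_(s <- F) smod (xi s) ^+ 2.
have d0 : 0 < e ^+ 2 / c by rewrite divr_gt0 // exprn_gt0.
have hs : has_sup (range q).
  by split; [exists (q fset0), fset0 | exists M => _ [F _ <-]; exact: hM].
have [_ [F _ <-] hF] := sup_adherent d0 hs.
exists (partial_sum (fun s => xi s *: v s) F).
apply: filterS (near_totally F) => G FG.
rewrite hnormB !partial_sumE (sum_fset_split _ FG) addrC addKr.
rewrite -(@ltr_pXn2r _ 2) ?nnegrE ?hnorm_ge0 ?(ltW e0) //.
rewrite (le_lt_trans (synthesis_bound _ _)) // mulrC -ltr_pdivlMr //.
have : q G <= sup (range q) by apply: ub_le_sup; [case: hs | exists G].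
by rewrite /q (sum_fset_split _ FG) -/(q F); move: hF; lra.
Qed.

Definition frame_operator : H -> H := adjoint (analysis v) \o analysis v.

Lemma inner_partial_sum xi F g :
  inner (partial_sum (fun s => xi s *: v s) F) g =
  partial_sum (fun s => sconj (xi s) * inner (v s) g : K^o) F.
Proof.
by rewrite !partial_sumE inner_suml; apply: eq_bigr => s _; rewrite innerZl.
Qed.

(** The sum of the [<v s | f> v s] has the weak characterisation by which
    [adjoint] is defined, and inner products determine a vector. *)
Lemma frame_operator_cvg f :
  partial_sum (fun s => analysis v f s *: v s) @ totally --> frame_operator f.
Proof.
have [y hy] := synthesis_cvg (bessel_fset f).
suff -> : frame_operator f = y by [].
have Py g : inner y g = l2inner (analysis v f) (analysis v g).
  have h : partial_sum (fun s => sconj (analysis v f s) * inner (v s) g : K^o)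
      @ totally --> (inner y g : K^o).
    by apply: cvg_ext (cvg_innerl hy) => F; rewrite inner_partial_sum.
  exact/esym/(cvg_lim (@norm_hausdorff _ K^o) h).
have := @getPex H [set y | forall g, inner y g = l2inner (analysis v f) (analysis v g)].
move=> /(_ (ex_intro _ y Py)) Pg.
by apply: inner_ext => g; rewrite Py; exact: Pg.
Qed.

Arguments frame_operator_cvg f : clear implicits.

Lemma frame_operator_linear : linear frame_operator.
Proof.
move=> a f g; apply: (cvg_uniq (frame_operator_cvg _)).
apply: cvg_ext (cvgD (cvgZr (frame_operator_cvg f)) (frame_operator_cvg g)) => F /=.
rewrite -[RHS]/(a *: partial_sum _ F + partial_sum _ F) !partial_sumE.
rewrite scaler_sumr -big_split /=; apply: eq_bigr => s _.
by rewrite /analysis innerDr innerZr scalerDl scalerA.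
Qed.

Lemma frame_operator_sym f g :
  inner f (frame_operator g) = inner (frame_operator f) g.
Proof.
apply: (cvg_uniq (cvg_innerr (y := f) (frame_operator_cvg g))).
apply: cvg_ext (cvg_innerl (frame_operator_cvg f)) => F /=.
rewrite !partial_sumE inner_suml inner_sumr; apply: eq_bigr => s _.
by rewrite innerZr innerZl sconj_inner mulrC.
Qed.

Lemma sqsum_partial_cvg f :
  partial_sum (fun s => smod (analysis v f s) ^+ 2) @ totally
    --> sRe (inner f (frame_operator f)).
Proof.
apply: cvg_ext (cvg_sRe (cvg_innerr (frame_operator_cvg f))) => F /=.
rewrite !partial_sumE inner_sumr raddf_sum; apply: eq_bigr => s _ /=.
by rewrite innerZr mulrC -sconj_inner sRe_mul_sconj.
Qed.

Lemma sqsum_analysis f :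
  sqsum (analysis v f) = (sRe (inner f (frame_operator f)))%:E.
Proof. exact/sqsum_cvg/sqsum_partial_cvg. Qed.

(** The bound on synthesis for the coefficients of [f], whose square sum is
    [<f | P f>]. *)
Lemma frame_operator_bound f :
  hnorm (frame_operator f) ^+ 2 <= c * sRe (inner f (frame_operator f)).
Proof.
have h : hnorm (partial_sum (fun s => analysis v f s *: v s) F)
    @[F --> totally] --> hnorm (frame_operator f).
  exact: cvg_hnorm (frame_operator_cvg f).
rewrite [leLHS]expr2; apply: (cvgr_to_le (cvgM h h)); near=> F.
rewrite -[leLHS]/(hnorm _ * hnorm _) -expr2 partial_sumE.
rewrite (le_trans (synthesis_bound _ _)) // ler_wpM2l ?(ltW c0) //.
by apply: (sqsum_leP (analysis v f) _).1; rewrite sqsum_analysis.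
Unshelve. all: end_near.
Qed.

Lemma abs_analysis_sqrt : is_sqrt_operator frame_operator (abs_analysis v).
Proof.
have [T hT] := exists_sqrt c0 frame_operator_linear frame_operator_sym
  frame_operator_bound.
by apply: getPex; exists T.
Qed.

End Bessel.
End Sums.

Arguments frame_operator_cvg {R k S H v c} _ _ f.

(** * Closed spans *)

Section ClosedSpan.
Context (R : realType) (k : scalar_kind) (S : countType) (H : hilbertType R k).
Local Notation K := (scalars R k).
Variable v : S -> H.

Let span := [set f | exists (r : seq S) (c : S -> K),
                     f = \sum_(s <- r) c s *: v s].

(** Two linear combinations come with unrelated index sequences, possibly with
    repetitions; rewriting both over one duplicate-free sequence lets their
    coefficients be added. *)
Lemma sum_count_mem (f : S -> H) (r U : seq S) : uniq U -> {subset r <= U} ->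
  \sum_(s <- r) f s = \sum_(s <- U) f s *+ count_mem s r.
Proof.
move=> uU; elim: r => [|t r IH] sub.
  by rewrite big_nil big1.
have tU : t \in U by rewrite sub ?mem_head.
rewrite big_cons IH => [|s sr]; last by rewrite sub // in_cons sr orbT.
under [RHS]eq_bigr do rewrite /= mulrnDr.
rewrite big_split /= [in RHS](bigD1_seq t) //= eqxx; congr (_ + _).
by rewrite big1 ?addr0 // => s /negPf; rewrite eq_sym => ->.
Qed.

Lemma span_subspace : subspace span.
Proof.
split; first by exists [::], (fun=> 0); rewrite big_nil.
move=> a _ _ [r [c ->]] [r' [c' ->]].
exists (undup (r ++ r')), (fun s => a * (c s *+ count_mem s r) + c' s *+ count_mem s r').
rewrite (@sum_count_mem _ r (undup (r ++ r'))) ?undup_uniq //; last first.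
  by move=> s; rewrite mem_undup mem_cat => ->.
rewrite (@sum_count_mem _ r' (undup (r ++ r'))) ?undup_uniq //; last first.
  by move=> s; rewrite mem_undup mem_cat => ->; rewrite orbT.
rewrite scaler_sumr -big_split /=; apply: eq_bigr => s _.
by rewrite scalerDl -scalerA !scalerMnl.
Qed.

Lemma closed_span_subspace : subspace (closed_span v).
Proof. exact: closure_subspace span_subspace. Qed.

Lemma closure_closed_span : closure (closed_span v) = closed_span v.
Proof. by apply/esym/closure_id; exact: closed_closure. Qed.

Lemma closed_span_in s : closed_span v (v s).
Proof.
by apply: subset_closure; exists [:: s], (fun=> 1); rewrite big_seq1 scale1r.
Qed.

Lemma orthogonal_closed_span z : (forall s, inner (v s) z = 0) ->
  forall x, closed_span v x -> inner z x = 0.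
Proof.
move=> h; apply: orthogonal_closure => _ [r [c ->]].
rewrite inner_sumr big1 // => s _.
by rewrite innerZr -sconj_inner h raddf0 mulr0.
Qed.

Lemma closed_span_decomposition x : exists2 p, closed_span v p &
  forall y, closed_span v y -> inner (x - p) y = 0.
Proof. exact: orthogonal_decomposition span_subspace. Qed.

Lemma closed_span_full : (forall z, (forall s, inner (v s) z = 0) -> z = 0) ->
  closed_span v = [set: H].
Proof.
move=> h; apply/seteqP; split=> // x _.
have [p vp hp] := closed_span_decomposition x.
suff /eqP : x - p = 0 by rewrite subr_eq0 => /eqP ->.
apply: h => s; rewrite -sconj_inner hp ?raddf0 //; exact: closed_span_in.
Qed.

End ClosedSpan.

(** * Square-summable families *)

Section L2.
Context (R : realType) (k : scalar_kind) (S : countType).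
Local Notation K := (scalars R k).
Implicit Types (xi eta : S -> K) (F : {fset S}).

(** Finiteness matters below because the real part [fine] of an infinite square
    sum is 0. *)
Lemma l2_fin_num xi : l2 xi -> sqsum xi \is a fin_num.
Proof.
by move=> xi2; rewrite ge0_fin_numE //; apply: esum_ge0 => s _; rewrite lee_fin sqr_ge0.
Qed.

Lemma l2_sum_le xi F : l2 xi ->
  \sum_(s <- F) smod (xi s) ^+ 2 <= fine (sqsum xi).
Proof. by move=> /l2_fin_num fin; move: F; apply/sqsum_leP; rewrite fineK. Qed.

Lemma smod_le_l2norm xi s : l2 xi -> smod (xi s) <= l2norm xi.
Proof.
move=> xi2; have h := l2_sum_le [fset s]%fset xi2; rewrite big_seq_fset1 in h.
rewrite -(@ler_pXn2r _ 2) ?nnegrE ?sqrtr_ge0 ?(hnorm_ge0 (_ : K^o)) //.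
by rewrite sqr_sqrtr // (le_trans (sqr_ge0 _) h).
Qed.

Lemma l2B xi eta : l2 xi -> l2 eta -> l2 (xi - eta).
Proof.
move=> xi2 eta2; set M := fine (sqsum xi); set N := fine (sqsum eta).
rewrite /l2 /= (le_lt_trans _ (ltry (2 * M + 2 * N))) //.
apply/sqsum_leP => F.
apply: (@le_trans _ _ (2 * \sum_(s <- F) smod (xi s) ^+ 2
                       + 2 * \sum_(s <- F) smod (eta s) ^+ 2)); last first.
  by rewrite lerD // ler_wpM2l // l2_sum_le.
rewrite !mulr_sumr -big_split /=; apply: ler_sum => s _.
have := hnormD (xi s : K^o) (- eta s); rewrite hnormN => h.
have := hnorm_ge0 (xi s - eta s : K^o); move: h.
rewrite -[smod ((xi - eta) s)]/(hnorm (xi s - eta s : K^o)).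
rewrite -[smod (xi s)]/(hnorm (xi s : K^o)) -[smod (eta s)]/(hnorm (eta s : K^o)).
set a := hnorm _; set b := hnorm _; set d := hnorm _ => h d0.
have := sqr_ge0 (b - d).
nra.
Qed.

End L2.

(** * The polar decomposition and the derived Parseval frame *)

Section Polar.
Context (R : realType) (k : scalar_kind) (S : countType) (H : hilbertType R k).
Local Notation K := (scalars R k).

(** Only finite sums are continuous for free; the full square sum is then
    reached as a supremum. *)
Lemma closure_bessel_fset (D : set H) (u : S -> H) (F : {fset S}) :
  (forall y, D y -> \sum_(s <- F) smod (inner (u s) y) ^+ 2 <= hnorm y ^+ 2) ->
  forall f, closure D f -> \sum_(s <- F) smod (inner (u s) f) ^+ 2 <= hnorm f ^+ 2.
Proof.
move=> hD f hf.
have pf : ProperFilter (within D (nbhs f)) by exact: within_nbhs_proper.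
have idf : (id : H -> H) y @[y --> within D (nbhs f)] --> f.
  exact: cvg_within.
have sq (g : H -> R) (l : R) : g y @[y --> within D (nbhs f)] --> l ->
    g y ^+ 2 @[y --> within D (nbhs f)] --> l ^+ 2.
  by move=> gl; rewrite expr2; under eq_cvg do rewrite expr2; exact: cvgM.
have hsum : \sum_(s <- F) smod (inner (u s) y) ^+ 2 @[y --> within D (nbhs f)]
    --> \sum_(s <- F) smod (inner (u s) f) ^+ 2.
  elim: (enum_fset F) => [|s r IH].
    by rewrite big_nil; under eq_cvg do rewrite big_nil; exact: cvg_cst.
  rewrite big_cons; under eq_cvg do rewrite big_cons.
  by apply: cvgD => //; apply: sq; exact: (@cvg_hnorm _ _ K^o) (cvg_innerr idf).
apply: (ler_cvg_to hsum (sq _ _ (cvg_hnorm idf))).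
by rewrite near_withinE; near=> y => Dy; exact: hD.
Unshelve. all: end_near.
Qed.

Variables (v : S -> H) (c : R) (c0 : 0 < c) (bv : bessel v c).
Local Notation Hin := (closed_span v).
Local Notation T := (abs_analysis v).
Local Notation P := (frame_operator v).
Local Notation w := (derived v).
Implicit Types (x y z f : H).

Let Tlin : linear T.
Proof. by have [[]] := abs_analysis_sqrt c0 bv. Qed.

Let Tsym x y : inner x (T y) = inner (T x) y.
Proof. by have [[]] := abs_analysis_sqrt c0 bv. Qed.

Let TT x : T (T x) = P x.
Proof. by have [_ <-] := abs_analysis_sqrt c0 bv. Qed.

(** The isometry [T x |-> V x]. *)
Lemma sqsum_abs x : sqsum (analysis v x) = (hnorm (T x) ^+ 2)%:E.
Proof. by rewrite (sqsum_analysis c0 bv) -TT Tsym inner_self ofRK. Qed.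

Lemma analysis_l2 x : l2 (analysis v x).
Proof. by rewrite /l2 /= sqsum_abs ltry. Qed.

Lemma analysis_le s x : smod (inner (v s) x) <= hnorm (T x).
Proof.
have := smod_le_l2norm s (analysis_l2 x).
by rewrite /l2norm sqsum_abs /= sqrtr_sqr (ger0_norm (hnorm_ge0 _)).
Qed.

Lemma abs_eq0 x : T x = 0 <-> forall s, inner (v s) x = 0.
Proof.
split=> [Tx0 s|h].
  apply/(@hnorm0_eq0 _ _ K^o)/eqP; rewrite eq_le (hnorm_ge0 (_ : K^o)) andbT.
  by rewrite (le_trans (analysis_le s x)) // Tx0 hnorm0.
have : sqsum (analysis v x) = 0%:E.
  by rewrite /sqsum esum1 // => s _; rewrite /analysis h normr0 raddf0 expr0n.
by rewrite sqsum_abs => -[/eqP]; rewrite sqrf_eq0 => /eqP/hnorm0_eq0.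
Qed.

(** The component of [T x] orthogonal to [Hin] is killed by [V], hence by [T],
    hence is orthogonal to the range of the symmetric operator [T]. *)
Lemma abs_in x : Hin (T x).
Proof.
have [p hp ort] := closed_span_decomposition v (T x).
suff /eqP : T x - p = 0 by rewrite subr_eq0 => /eqP ->.
set z := T x - p in ort *.
have Tz : T z = 0.
  by apply/abs_eq0 => s; rewrite -sconj_inner ort ?raddf0 //; exact: closed_span_in.
apply/hnorm0_eq0/eqP; rewrite -sqrf_eq0; apply/eqP.
rewrite -[LHS](ofRK k) -inner_self {2}/z innerBr (ort p hp) subr0 Tsym Tz.
by rewrite inner0l raddf0.
Qed.

Lemma abs_inj : {in Hin &, injective T}.
Proof.
move=> x y /set_mem hx /set_mem hy Txy.
have hxy : Hin (x - y) by exact: subspaceB (closed_span_subspace v) hx hy.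
have /abs_eq0/orthogonal_closed_span/(_ _ hxy) : T (x - y) = 0.
  by rewrite linB // Txy subrr.
rewrite inner_self -(raddf0 (@ofR R k)) => /(can_inj (ofRK k)) /eqP.
by rewrite sqrf_eq0 => /eqP /hnorm0_eq0 /eqP; rewrite subr_eq0 => /eqP.
Qed.

Lemma inv_absK x : Hin x -> inv_abs v (T x) = x.
Proof.
move=> hx; have := @getPex H [set x' | Hin x' /\ T x' = T x] (ex_intro _ x (conj hx erefl)).
by case=> hy Ty; apply: abs_inj; [exact/mem_set|exact/mem_set|exact: Ty].
Qed.

Lemma range_abs_subspace : subspace (range T).
Proof.
split; first by exists 0 => //; rewrite lin0.
by move=> a _ _ [x _ <-] [y _ <-]; exists (a *: x + y) => //; rewrite Tlin.
Qed.

(** Restricting [T] to [Hin] loses nothing of its range, as [T] vanishes on the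
    orthogonal complement. *)
Lemma range_abs : range T = inv_abs_dom v.
Proof.
apply/seteqP; split=> [_ [x _ <-]|_ [x _ <-]]; last by exists x.
have [p hp ort] := closed_span_decomposition v x; exists p => //.
have /eqP : T (x - p) = 0.
  by apply/abs_eq0 => s; rewrite -sconj_inner ort ?raddf0 //; exact: closed_span_in.
by rewrite linB // subr_eq0 => /eqP.
Qed.

(** A vector of [Hin] orthogonal to the range of [T] is killed by [T], which is
    injective on [Hin]. *)
Lemma closure_range_abs : closure (range T) = Hin.
Proof.
apply/seteqP; split=> [|f hf].
  by rewrite -[X in _ `<=` X]closure_closed_span; apply: closure_subset => _ [x _ <-];
    exact: abs_in.
have [q hq ort] := orthogonal_decomposition f range_abs_subspace.
suff /eqP : f - q = 0 by rewrite subr_eq0 => /eqP ->.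
have hq' : Hin q.
  by rewrite -closure_closed_span; apply: closure_subset hq => _ [x _ <-]; exact: abs_in.
have hz : Hin (f - q) by exact: subspaceB (closed_span_subspace v) hf hq'.
apply: abs_inj; [exact/mem_set| |].
  by apply/mem_set; case: (closed_span_subspace v).
rewrite lin0 //; apply: inner_eq0 => x.
by rewrite -Tsym ort //; apply: subset_closure; exists x.
Qed.

(** [V*] and [T] have the same range; only the values [v s] of [V*] on the
    standard basis are needed.  They are reached by representing the bounded
    functional [T x |-> <v s | x>] on the range of [T]. *)
Lemma range_abs_in s : exists2 u, Hin u & T u = v s.
Proof.
(* any preimage under T will do, since T x = 0 implies <v s | x> = 0 *)
pose phi y := inner (v s) (get [set x | T x = y]).
have phiT x : phi (T x) = inner (v s) x.
  rewrite /phi; set x' := get _.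
  have Tx' : T x' = T x by apply: (@getPex H [set x' | T x' = T x]); exists x.
  apply/eqP; rewrite -subr_eq0 -innerBr; apply/eqP.
  by apply: (abs_eq0 _).1; rewrite linB // Tx' subrr.
have [|||u hu uT] := @riesz R k H (range T) phi 1.
- exact: range_abs_subspace.
- move=> a _ _ [x _ <-] [y _ <-].
  by rewrite -Tlin !phiT innerDr innerZr.
- by move=> _ [x _ <-]; rewrite phiT mul1r; exact: analysis_le.
exists u; first by rewrite -closure_range_abs.
by apply: inner_ext => x; rewrite -Tsym uT ?phiT //; exists x.
Qed.

Lemma derivedP s : Hin (w s) /\ T (w s) = v s.
Proof. by have [u hu Tu] := range_abs_in s; rewrite /derived -Tu inv_absK. Qed.

Lemma derived_in s : Hin (w s).
Proof. by case: (derivedP s). Qed.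

Lemma analysis_derived x : analysis w (T x) = analysis v x.
Proof.
apply/funext => s; rewrite /analysis Tsym.
by case: (derivedP s) => _ ->.
Qed.

(** The inequality holds on the range of [T] by isometry, passes to its closure
    [Hin], and extends to all vectors since [w] does not see the component
    orthogonal to [Hin]. *)
Lemma bessel_derived : bessel w 1.
Proof.
move=> f; rewrite mul1r; apply/sqsum_leP => F.
have [p hp ort] := closed_span_decomposition v f.
have -> : \sum_(s <- F) smod (analysis w f s) ^+ 2
    = \sum_(s <- F) smod (inner (w s) p) ^+ 2.
  apply: eq_bigr => s _; congr (smod _ ^+ 2); apply/eqP.
  rewrite /analysis -subr_eq0 -innerBr -sconj_inner ort ?raddf0 //.
  exact: derived_in.
apply: (@le_trans _ _ (hnorm p ^+ 2)).
  move: hp; rewrite -closure_range_abs; apply: closure_bessel_fset.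
  move=> _ [x _ <-]; apply: (sqsum_leP (analysis w (T x)) _).1.
  by rewrite analysis_derived sqsum_abs.
have -> : hnorm f ^+ 2 = hnorm (f - p) ^+ 2 + hnorm p ^+ 2.
  have := hnormD_sq (f - p) p.
  by rewrite subrK (ort p hp) raddf0 mulr0 addr0.
by rewrite lerDr sqr_ge0.
Qed.

(** Let [Q] be the frame operator of [w].  On the range of [T] the forms
    [<Q y | z>] and [<y | z>] agree, both being a sum of products of coefficients
    [V].  Symmetry of [Q] and density of the range in [Hin], used once in each
    variable, give [<f | Q f> = <f | f>] for [f] in [Hin], without a triangle
    inequality for square sums. *)
Lemma parseval_derived : parseval_frame_in Hin w.
Proof.
split=> [s|f hf]; first exact: derived_in.
have ltr01 := @ltr01 R.
pose Q := frame_operator w.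
have QT x y : inner (Q (T x)) (T y) = inner (T x) (T y).
  rewrite -[RHS]Tsym TT (frame_operator_sym c0 bv).
  apply: (cvg_uniq (cvg_innerl (frame_operator_cvg ltr01 bessel_derived (T x)))).
  apply: cvg_ext (cvg_innerl (frame_operator_cvg c0 bv x)) => F.
  rewrite !inner_partial_sum analysis_derived !partial_sumE.
  apply: eq_bigr => s _; congr (_ * _).
  exact: (congr1 (@^~ s) (analysis_derived y)).
have Qf x : inner (Q f - f) (T x) = 0.
  rewrite innerBl -(frame_operator_sym ltr01 bessel_derived) -sconj_inner.
  rewrite -(sconj_inner (T x)) -raddfB /= -innerBl.
  rewrite (@orthogonal_closure _ _ _ (range T)) ?raddf0 //.
    by move=> _ [y _ <-]; rewrite innerBl QT subrr.
  by rewrite closure_range_abs.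
rewrite (sqsum_analysis ltr01 bessel_derived); congr EFin.
rewrite -[RHS](ofRK k) -inner_self; congr sRe; apply/eqP.
rewrite -subr_eq0 -innerBr -sconj_inner.
rewrite (@orthogonal_closure _ _ _ (range T)) ?raddf0 //.
  by move=> _ [x _ <-]; exact: Qf.
by rewrite closure_range_abs.
Qed.

Lemma analysis_inv_abs y : inv_abs_dom v y ->
  analysis v (inv_abs v y) = analysis w y.
Proof.
by move=> [x hx <-]; rewrite inv_absK // analysis_derived.
Qed.

Lemma l2norm_derived f : Hin f -> l2norm (analysis w f) = hnorm f.
Proof.
move=> hf; rewrite /l2norm (parseval_derived.2 f hf) /= sqrtr_sqr.
by rewrite (ger0_norm (hnorm_ge0 _)).
Qed.

Lemma inv_abs_dom_in f : inv_abs_dom v f -> Hin f.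
Proof. by move=> [x _ <-]; exact: abs_in. Qed.

Lemma closure_inv_abs_dom : closure (inv_abs_dom v) = Hin.
Proof. by rewrite -range_abs closure_range_abs. Qed.

Lemma derived_polar_value f : Hin f -> is_polar_value v f (analysis w f).
Proof.
move=> hf; split; first by rewrite /l2 /= (parseval_derived.2 f hf) ltry.
apply/cvgrPdist_lt => e e0; rewrite near_withinE.
have /cvg_hnormP /(_ _ e0) : (id : H -> H) y @[y --> f] --> f by exact: cvg_id.
apply: filterS => y fy Dy; rewrite sub0r normrN analysis_inv_abs //.
have -> : analysis w y - analysis w f = analysis w (y - f).
  by apply/funext => s; rewrite /analysis innerBr.
have hy := inv_abs_dom_in Dy.
rewrite l2norm_derived; last exact: subspaceB (closed_span_subspace v) hy hf.
by rewrite (ger0_norm (hnorm_ge0 _)) hnormB.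
Qed.

(** Square-summable limits along the domain of [T^-1], dense in [Hin], are unique
    because each coordinate is dominated by the norm of [l2]. *)
Lemma is_polar_value_uniq f xi eta : Hin f ->
  is_polar_value v f xi -> is_polar_value v f eta -> xi = eta.
Proof.
rewrite -closure_inv_abs_dom => hf [xi2 xiP] [eta2 etaP].
have pf : ProperFilter (within (inv_abs_dom v) (nbhs f)).
  exact: within_nbhs_proper.
apply/funext => s; apply/eqP; rewrite -subr_eq0; apply/eqP.
apply/(@hnorm0_eq0 _ _ K^o)/eqP; rewrite eq_le (hnorm_ge0 (_ : K^o)) andbT.
rewrite -[leRHS](addr0 0); apply: (cvgr_to_ge (cvgD etaP xiP)).
near=> y.
pose zeta := analysis v (inv_abs v y).
have := smod_le_l2norm s (l2B (analysis_l2 (inv_abs v y)) xi2).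
have := smod_le_l2norm s (l2B (analysis_l2 (inv_abs v y)) eta2).
rewrite -/zeta => h1 h2.
rewrite -[leRHS]/(l2norm (zeta - eta) + l2norm (zeta - xi)).
apply: le_trans (lerD h1 h2).
have := hnormD (zeta s - eta s : K^o) (- (zeta s - xi s)); rewrite hnormN.
have -> // : zeta s - eta s + - (zeta s - xi s) = xi s - eta s.
by rewrite opprB addrC addrA subrK.
Unshelve. all: end_near.
Qed.

(** [W] is the analysis operator of the derived frame. *)
Lemma polarE f : Hin f -> polar v f = analysis w f.
Proof.
move=> hf; have hp := derived_polar_value hf.
exact: is_polar_value_uniq hf (getI hp) hp.
Qed.

Lemma parseval_full_iff :
  parseval_frame_in [set: H] w <-> Hin = [set: H].
Proof.
split=> [[_ pw]|Hfull]; last first.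
  by have := parseval_derived; rewrite Hfull.
apply: closed_span_full => z hz.
have : sqsum (analysis w z) = 0%:E.
  rewrite /sqsum esum1 // => s _.
  rewrite /analysis -sconj_inner (orthogonal_closed_span hz) ?raddf0.
    by rewrite normr0 raddf0 expr0n.
  exact: derived_in.
by rewrite pw // => -[/eqP]; rewrite sqrf_eq0 => /eqP /hnorm0_eq0.
Qed.

Lemma frame_closed_span : frame v -> Hin = [set: H].
Proof.
move=> [A1 [A2 [A10 _ fr]]]; apply: closed_span_full => z hz.
have [+ _] := fr z.
have -> : sqsum (analysis v z) = 0%:E.
  by rewrite /sqsum esum1 // => s _; rewrite /analysis hz normr0 raddf0 expr0n.
rewrite lee_fin pmulr_rle0 // => h.
by apply/hnorm0_eq0/eqP; rewrite -sqrf_eq0 eq_le h sqr_ge0.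
Qed.

End Polar.

Theorem theorem6p2 (R : realType) (k : scalar_kind) (S : countType)
    (H : hilbertType R k) (v : S -> H) (A : R) (hv : bessel v A) :
  let Hin := closed_span v in
  let w := derived v in
  let T := abs_analysis v in
  let W := polar v in
  (* (a) *)
  parseval_frame_in Hin w /\
  (* (b) *)
  ((parseval_frame_in [set: H] w <-> Hin = [set: H]) /\
   (frame v -> parseval_frame_in [set: H] w)) /\
  (* (c) *)
  ([/\ is_sqrt_operator (adjoint (analysis v) \o analysis v) T,
       {in Hin &, injective T},
       closure (inv_abs_dom v) = Hin,
       forall f, Hin f -> is_polar_value v f (W f) &
       forall f, inv_abs_dom v f -> W f = analysis v (inv_abs v f)] /\
   [/\ forall (a : scalars R k) f g, Hin f -> Hin g ->
         forall s, W (a *: f + g) s = a * W f s + W g s,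
       forall f, Hin f -> l2norm (W f) = hnorm f,
       forall s, inv_abs_dom v (v s) &
       parseval_frame_in Hin w]).
Proof.
move=> Hin w T W.
(* A itself may fail to be positive if H is trivial or v vanishes *)
have c0 : 0 < Num.max A 1 by rewrite lt_max ltr01 orbT.
have bv : bessel v (Num.max A 1).
  move=> f; apply: le_trans (hv f) _.
  by rewrite lee_fin ler_wpM2r ?sqr_ge0 // le_max lexx.
have WE f : Hin f -> W f = analysis w f by exact: (polarE c0 bv).
have pw := parseval_derived c0 bv.
split=> //; split; first split.
- exact: (parseval_full_iff c0 bv).
- by move=> /frame_closed_span Hfull; apply/(parseval_full_iff c0 bv).
split; split => //.
- exact: (abs_analysis_sqrt c0 bv).
- exact: (abs_inj c0 bv).
- exact: (closure_inv_abs_dom c0 bv).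
- by move=> f hf; rewrite WE //; exact: (derived_polar_value c0 bv).
- move=> f hf; rewrite (analysis_inv_abs c0 bv hf) WE //.
  exact: (inv_abs_dom_in c0 bv).
- move=> a f g hf hg s; have [_ lin] := closed_span_subspace v.
  by rewrite !WE //; [rewrite /analysis innerDr innerZr | exact: lin].
- by move=> f hf; rewrite WE // (l2norm_derived c0 bv).
- by move=> s; have [? <-] := derivedP c0 bv s; exists (w s).
Qed.
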